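(* Let $X$ be a transitive subshift of finite type and let $r\colon X\to(0,\infty)$ be a roof function satisfying the Walters property. If the suspension flow over $(X,\sigma)$ with roof function $r$ is not topologically mixing, then there exists a $\delta>0$ such that $r$ is cohomologous to a locally constant roof function $s\colon X\to\delta\mathbb{N}$, where $\delta\mathbb{N}=\{\delta n: n\in\mathbb{N}\}$ and $\mathbb{N}=\{1,2,\dots\}$.
   Context: Let $A$ be a finite alphabet. $A^{\mathbb{Z}}$ has the metric $d(x,y)=2^{-\min\{|n|: x_n\neq y_n\}}$ (and $d(x,x)=0$), and $\sigma$ is the left shift $(\sigma x)_n=x_{n+1}$. A shift space is a nonempty closed $\sigma$-invariant ($\sigma(X)=X$) set $X\subset A^{\mathbb{Z}}$; it is a subshift of finite type if it is the set of sequences avoiding some finite set of forbidden words. For $x \in A^{\mathbb Z}$, $x_{[i,j]}=x_i\cdots x_j$. The language $\mathcal{L}$ of $X$ is the set of all finite words appearing in some $x\in X$. $X$ is transitive if for all $u,v\in\mathcal{L}$ there is $w\in\mathcal{L}$ with $uwv\in\mathcal{L}$. A function $r\colon X\to\mathbb{R}$ satisfies the Walters property if for every $\varepsilon>0$ there is $k\ge 0$ such that for all $n\in\mathbb{N}$ and all $x,y\in X$ with $x_{[-k,n+k]}=y_{[-k,n+k]}$ we have $\left|\sum_{j=0}^{n-1}\big(r(\sigma^jx)-r(\sigma^jy)\big)\right|<\varepsilon$. A function on $X$ is locally constant if every point of $X$ has a neighborhood on which the function is constant. Two roof functions $r,s$ on $X$ are cohomologous if there is a continuous function $g\colon X\to\mathbb{R}$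 with $r(x)-s(x)=g(\sigma x)-g(x)$ for all $x\in X$. Suspension flow: given $r\colon X\to(0,\infty)$, let $M_r=\{(x,t)\in X\times[0,\infty): 0\le t\le r(x)\}/\sim$, with the quotient topology, where $(x,r(x))\sim(\sigma x,0)$. The suspension flow is $\varphi^T(x,s)=(\sigma^n x,s')$, where $n$ and $s'$ satisfy $\sum_{j=0}^{n-1}r(\sigma^jx)+s'=T+s$ and $0\le s'\le r(\sigma^nx)$. It is topologically mixing if for all nonempty open $U,V\subset M_r$ there is $T\in\mathbb{R}$ such that $\varphi^t(U)\cap V\neq\emptyset$ for all $t\ge T$. *)

(* Defs.v *)
From HB Require Import structures.
From Stdlib Require Import Relation_Operators.
From mathcomp Require Import all_boot all_order all_algebra generic_quotient.
From mathcomp Require Import all_classical all_reals all_analysis.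

Set Implicit Arguments.
Unset Strict Implicit.
Unset Printing Implicit Defensive.

Import Order.TTheory GRing.Theory Num.Theory.
Import numFieldNormedType.Exports.

Local Open Scope classical_set_scope.
Local Open Scope ring_scope.

(* [R] is a phantom parameter: it records the field in which the distance
   takes its values, so that the metric structure can be inferred. *)
Definition fullshift (R : realType) (A : finType) : Type := int -> A.

HB.instance Definition _ (R : realType) (A : finType) :=
  Choice.copy (fullshift R A) (int -> A).

Section FullShift.
Context {R : realType} {A : finType}.
Local Notation AZ := (fullshift R A).
Implicit Types (x y z : AZ).

Definition differ_at x y (m : nat) : bool :=
  (x m%:Z != y m%:Z) || (x (- m%:Z) != y (- m%:Z)).

(* 2 ^- min {|n| : x n <> y n}, and 0 when x and y agree everywhere *)
Definition shift_dist x y : R :=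
  if pselect (exists m, differ_at x y m) is left xy
  then (2 ^+ ex_minn xy)^-1 else 0.

Lemma differ_atC x y : differ_at x y =1 differ_at y x.
Proof.
by move=> m; rewrite /differ_at (eq_sym (x m)) (eq_sym (x (- m%:Z))).
Qed.

Lemma shift_dist_ge0 x y : 0 <= shift_dist x y.
Proof.
by rewrite /shift_dist; case: pselect => // xy; rewrite invr_ge0 exprn_ge0.
Qed.

Lemma shift_dist_ge x y m : differ_at x y m -> (2 ^+ m)^-1 <= shift_dist x y.
Proof.
move=> dm; rewrite /shift_dist; case: pselect => [xy|[]]; last by exists m.
case: ex_minnP => k _ /(_ _ dm) km.
by rewrite lef_pV2 ?posrE ?exprn_gt0// ler_weXn2l// ler1n.
Qed.

Lemma shift_distxx x : shift_dist x x = 0.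
Proof.
rewrite /shift_dist; case: pselect => // xx; exfalso; case: xx => m.
by rewrite /differ_at !eqxx.
Qed.

Lemma shift_dist_eq0 x y : shift_dist x y = 0 -> x = y.
Proof.
move=> xy0; apply/funext => n; apply/eqP/negPn/negP => xyn.
have : differ_at x y `|n|%N.
  rewrite /differ_at; case: n xyn => k; first by rewrite absz_nat => ->.
  by rewrite NegzE abszN absz_nat => ->; rewrite orbT.
move/shift_dist_ge; rewrite xy0 leNgt => /negP; apply.
by rewrite invr_gt0 exprn_gt0.
Qed.

Lemma shift_distC x y : shift_dist x y = shift_dist y x.
Proof.
have le u v : shift_dist u v <= shift_dist v u.
  rewrite {1}/shift_dist; case: pselect => [uv|_]; last exact: shift_dist_ge0.
  by case: ex_minnP => k; rewrite differ_atC => /shift_dist_ge.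
by apply/eqP; rewrite eq_le !le.
Qed.

Lemma shift_dist_triangle y x z :
  shift_dist x z <= shift_dist x y + shift_dist y z.
Proof.
rewrite {1}/shift_dist; case: pselect => [xz|_]; last first.
  by rewrite addr_ge0// shift_dist_ge0.
case: ex_minnP => k xzk _.
have : differ_at x y k || differ_at y z k.
  move: xzk; apply: contraTT; rewrite /differ_at !negb_or !negbK.
  by move=> /andP[/andP[/eqP-> /eqP->]].
case/orP => /shift_dist_ge h.
- by rewrite (le_trans h)// lerDl shift_dist_ge0.
- by rewrite (le_trans h)// lerDr shift_dist_ge0.
Qed.

End FullShift.

HB.instance Definition _ (R : realType) (A : finType) :=
  isMetric.Build R (fullshift R A)
    (@shift_distxx R A) (@shift_dist_eq0 R A) (@shift_distC R A)
    (@shift_dist_triangle R A).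

Section Shifts.
Context {R : realType} {A : finType}.
Local Notation AZ := (fullshift R A).
Implicit Types (x y : AZ) (X : set AZ) (i j : int) (r s g : AZ -> R).

(* the n-th power of the left shift, for an integer n of any sign *)
Definition shift_pow (n : int) x : AZ := fun i => x (i + n).

Definition left_shift : AZ -> AZ := shift_pow 1.

Lemma iter_shift (n : nat) x : iter n left_shift x = shift_pow n%:Z x.
Proof.
elim: n => [|n IHn] /=; first by apply/funext => i; rewrite /shift_pow addr0.
rewrite IHn; apply/funext => i.
by rewrite /left_shift /shift_pow -addrA -PoszD.
Qed.

Definition shift_space X := [/\ X !=set0, closed X & left_shift @` X = X].

(* x_[i,j], the empty word when j < i *)
Definition block x i j : seq A :=
  if i <= j then mkseq (fun m => x (i + m%:Z)) (absz (j - i + 1)) else [::].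

Definition appears (w : seq A) x := exists i j, block x i j = w.

Definition language X : set (seq A) := [set w | exists2 x, X x & appears w x].

Definition finite_type X := exists F : seq (seq A),
  X = [set x | forall w, w \in F -> ~ appears w x].

Definition transitive_shift X := forall u v, language X u -> language X v ->
  exists2 w, language X w & language X (u ++ w ++ v).

(* Functions on X are represented by functions on the full shift; only their
   values on X are used below. *)

Definition walters X r := forall e : R, 0 < e ->
  exists k : nat, forall n : nat, (0 < n)%N -> forall x y, X x -> X y ->
    block x (- k%:Z) (n%:Z + k%:Z) = block y (- k%:Z) (n%:Z + k%:Z) ->
    `|\sum_(0 <= j < n)
        (r (iter j left_shift x) - r (iter j left_shift y))| < e.

Definition locally_constant X s := forall x, X x ->
  exists2 U, nbhs x U & forall y, U y -> X y -> s y = s x.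

Definition cohomologous X r s := exists2 g : AZ -> R,
  {within X, continuous g} &
  forall x, X x -> r x - s x = g (left_shift x) - g x.

(* \sum_(0 <= j < n) r (shift_pow j x) for an integer n, with the usual
   convention that for n < 0 this is - \sum_(n <= j < 0) r (shift_pow j x) *)
Definition birkhoff r (n : int) x : R :=
  match n with
  | Posz m => \sum_(0 <= j < m) r (shift_pow j%:Z x)
  | Negz m => - \sum_(0 <= j < m.+1) r (shift_pow (- j.+1%:Z) x)
  end.

End Shifts.

Section Suspension.
Context {R : realType} {A : finType}.
Variables (X : set (fullshift R A)) (r : fullshift R A -> R).

Definition suspension_domain : set (fullshift R A * R) :=
  [set p | X p.1 /\ 0 <= p.2 <= r p.1].

(* [suspension_domain] seen as a type carries the subspace topology *)
Definition glued (p q : suspension_domain) : Prop :=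
  (set_val p).2 = r (set_val p).1 /\ set_val q = (left_shift (set_val p).1, 0).

(* the equivalence relation generated by (x, r x) ~ (left_shift x, 0) *)
Definition suspension_equiv : rel suspension_domain :=
  fun p q => `[< clos_refl_sym_trans _ glued p q >].

Lemma suspension_equiv_refl : reflexive suspension_equiv.
Proof. by move=> p; apply/asboolP; exact: rst_refl. Qed.

Lemma suspension_equiv_sym : symmetric suspension_equiv.
Proof. by move=> p q; apply/asboolP/asboolP; exact: rst_sym. Qed.

Lemma suspension_equiv_trans : transitive suspension_equiv.
Proof.
by move=> q p t /asboolP pq /asboolP qt; apply/asboolP; exact: rst_trans pq qt.
Qed.

Canonical suspension_equiv_rel := EquivRel suspension_equiv
  suspension_equiv_refl suspension_equiv_sym suspension_equiv_trans.

Definition suspension_quot : quotType suspension_domain :=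
  {eq_quot suspension_equiv}%qT.

Definition suspension : Type := quotient_topology suspension_quot.

Definition suspension_pi (p : suspension_domain) : suspension :=
  (\pi_suspension p)%qT.

(* m = [(x, t)] and m' = [(shift_pow n x, t')] with birkhoff r n x + t' = T + t;
   the bounds 0 <= t <= r x and 0 <= t' <= r (shift_pow n x) hold because p and
   q are in [suspension_domain] *)
Definition flow_rel (T : R) (m m' : suspension) : Prop :=
  exists p q : suspension_domain, exists n : int,
    [/\ m = suspension_pi p, m' = suspension_pi q,
        (set_val q).1 = shift_pow n (set_val p).1 &
        birkhoff r n (set_val p).1 + (set_val q).2 = T + (set_val p).2].

(* When X is a shift space and r is continuous and positive on X, there is
   exactly one m' with flow_rel T m m', so the default value m is not used. *)
Definition suspension_flow (T : R) (m : suspension) : suspension :=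
  xget m (flow_rel T m).

Definition topologically_mixing : Prop :=
  forall U V : set suspension, open U -> open V -> U !=set0 -> V !=set0 ->
    exists T : R, forall t : R, T <= t -> suspension_flow t @` U `&` V !=set0.

End Suspension.

(* Main.v *)
(* Fix a periodic point p of period n0 and let l be its period under r. A
   "return at scale k" is an orbit segment of a point of X that starts and ends
   k-close to p; by the Walters property, return times add up when segments are
   glued, up to errors that vanish as k grows. Hence the limits, as k grows, of
   return times taken modulo integer multiples of l form a closed semigroup
   containing l and -l. If it has arbitrarily small positive elements, then
   inserting returns into an orbit that joins two given cylinders through p
   realizes every large time approximately, and the flow is mixing. Otherwise it
   is contained in a lattice delta Z. Then the time needed to go from x to a
   neighbourhood of p at scale k converges modulo delta as k grows, and a
   continuous lift g of this limit satisfies r + g o sigma - g in delta Z. This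
   function is locally constant, but perhaps not positive; its average over a
   long orbit segment is positive, takes values in (delta/N) Z, and is still
   cohomologous to r. *)
Require Import Defs.
From Stdlib Require Import Relation_Operators.
From mathcomp Require Import all_boot all_order all_algebra generic_quotient.
From mathcomp Require Import all_classical all_reals all_analysis.
From mathcomp Require Import zify ring lra.

Set Implicit Arguments.
Unset Strict Implicit.
Unset Printing Implicit Defensive.

Import Order.TTheory GRing.Theory Num.Theory.
Import numFieldNormedType.Exports.
Local Open Scope classical_set_scope.
Local Open Scope ring_scope.

(** * Gluing, closing and connecting orbits in a transitive shift of finite type *)

Section ShiftDynamics.
Context {R : realType} {A : finType}.
Local Notation AZ := (fullshift R A).
Implicit Types (x y z p : AZ) (X : set AZ) (a b i j m : int) (k n : nat).

Definition agree a b x y := forall i, a <= i <= b -> x i = y i.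

Lemma agree_sym a b x y : agree a b x y -> agree a b y x.
Proof. by move=> xy i /xy. Qed.

Lemma agree_trans a b y x z : agree a b x y -> agree a b y z -> agree a b x z.
Proof. by move=> xy yz i ab; rewrite xy// yz. Qed.

Lemma agree_sub a b a' b' x y :
  a' <= a -> b <= b' -> agree a' b' x y -> agree a b x y.
Proof. by move=> aa bb xy i ab; apply: xy; lia. Qed.

Lemma agree_leq k k' x y : (k <= k')%N ->
  agree (- k'%:Z) k' x y -> agree (- k%:Z) k x y.
Proof. by move=> kk; apply: agree_sub; lia. Qed.

Lemma agree_shift m a b x y :
  agree a b x y -> agree (a - m) (b - m) (shift_pow m x) (shift_pow m y).
Proof. by move=> xy i ab; rewrite /shift_pow xy//; lia. Qed.

Lemma shift_pow0 x : shift_pow 0 x = x.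
Proof. by apply/funext => i; rewrite /shift_pow addr0. Qed.

Lemma shift_powD m m' x : shift_pow m (shift_pow m' x) = shift_pow (m' + m) x.
Proof. by apply/funext => i; rewrite /shift_pow; congr x; lia. Qed.

Lemma shift_powK m x : shift_pow (- m) (shift_pow m x) = x.
Proof. by rewrite shift_powD subrr shift_pow0. Qed.

Lemma shift_pow_period p n m : shift_pow n p = p -> shift_pow (m * n%:Z) p = p.
Proof.
move=> pn; have pnat k : shift_pow (k%:Z * n%:Z) p = p.
  elim: k => [|k IH]; first by rewrite mul0r shift_pow0.
  by rewrite -[in RHS]pn -[in RHS]IH shift_powD; congr (shift_pow _ p); lia.
case: m => k; first exact: pnat.
by rewrite NegzE -[in RHS](shift_powK (k.+1%:Z * n%:Z) p) pnat mulNr.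
Qed.

Lemma block_agree a b x y : agree a b x y -> block x a b = block y a b.
Proof.
move=> xy; rewrite /block; case: ifP => // ab; rewrite /mkseq; apply/eq_in_map => l.
by rewrite mem_iota => lm; apply: xy; lia.
Qed.

Lemma size_block x a b : a <= b -> (size (block x a b))%:Z = b - a + 1.
Proof. by move=> ab; rewrite /block ab size_mkseq; lia. Qed.

Lemma shift_space_pow X m x : shift_space X -> X x -> X (shift_pow m x).
Proof.
case=> _ _ sX Xx.
have fwd y : X y -> X (left_shift y) by move=> Xy; rewrite -sX; exists y.
have bwd y : X y -> X (shift_pow (-1) y).
  by rewrite -{1}sX => -[w Xw <-]; rewrite /left_shift shift_powK.
have fwdn n y : X y -> X (shift_pow n y).
  by rewrite -iter_shift => Xy; elim: n => //= n; exact: fwd.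
have bwdn n y : X y -> X (shift_pow (- n%:Z) y).
  elim: n y => [|n IH] y Xy; first by rewrite oppr0 shift_pow0.
  have -> : - n.+1%:Z = - n%:Z + -1 by lia.
  by rewrite -shift_powD; apply/bwd/IH.
case: m => n; first exact: fwdn.
by rewrite NegzE; apply: bwdn.
Qed.

Lemma left_shift_pow x : left_shift x = shift_pow 1 x.
Proof. by []. Qed.

(** Finite type as finite memory: each window of [M + 1] letters may have its own witness [y], so a
    point pasted from pieces of points of [X] can be tested locally. *)
Definition window_determined X (M : nat) :=
  forall x, (forall i, exists2 y, X y & agree i (i + M%:Z) x y) -> X x.

Lemma finite_type_window X : finite_type X -> exists M, window_determined X M.
Proof.
(* The sum of the lengths bounds the length of each forbidden word, so an occurrence fits in one
   window. *)
case=> F FX; pose M := (\sum_(w <- F) size w)%N; exists M => x xw.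
rewrite FX => w wF [i [j xij]].
have wM : (size w <= M)%N by rewrite /M (big_rem w)//= leq_addr.
have [y + /agree_sym yx] := xw i; rewrite FX => /(_ w wF); apply.
exists i, j; rewrite -xij.
case: (leP i j) => [ij|ji]; last by rewrite /block leNgt ji.
apply/block_agree/agree_sub/yx => //.
move: wM (size_block x ij); rewrite -xij; move: (size _) => sz; lia.
Qed.

(** The overlap has more than [M] letters, so a window that ends after [b] starts after [a]: every
    window lies in one of the two pieces. *)
Lemma window_glue X M a b x y : window_determined X M -> a + M%:Z <= b ->
  X x -> X y -> agree a b x y ->
  exists z, [/\ X z, forall i, i <= b -> z i = x i & forall i, a <= i -> z i = y i].
Proof.
move=> XM ab Xx Xy xy; pose z : AZ := fun i => if i <= b then x i else y i.
have zx i : i <= b -> z i = x i by rewrite /z => ->.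
have zy i : a <= i -> z i = y i.
  by rewrite /z => ai; case: ifP => // ib; apply: xy; rewrite ai.
exists z; split => //; apply: XM => i.
case: (leP (i + M%:Z) b) => ib.
  by exists x => // l il; apply: zx; lia.
by exists y => // l il; apply: zy; lia.
Qed.

(* The periodic sequence whose period is the word [z_[-k, n-k-1]]. *)
Lemma window_closing X M k n z : shift_space X -> window_determined X M ->
  (M <= 2 * k)%N -> (0 < n)%N -> X z ->
  agree (- k%:Z) k z (shift_pow n z) ->
  exists y, [/\ X y, shift_pow n y = y & agree (- k%:Z) (n%:Z + k%:Z) y z].
Proof.
move=> sX XM Mk n0 Xz zz.
pose y : AZ := fun i => z (- k%:Z + ((i + k%:Z) %% n%:Z)%Z).
have yn : shift_pow n y = y.
  apply/funext => i; rewrite /shift_pow /y.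
  by rewrite addrAC modzDr.
(* The first [n] letters agree by construction; beyond them both sequences repeat with step [n], [z]
   because its two ends agree. *)
have yz : forall l : nat, (l <= n + 2 * k)%N -> y (- k%:Z + l%:Z) = z (- k%:Z + l%:Z).
  elim/ltn_ind => l IH ln; case: (ltnP l n) => [lltn|nl].
    by rewrite /y addrAC addNr add0r modz_small//; lia.
  have e : - k%:Z + l%:Z = - k%:Z + (l - n)%:Z + n%:Z by lia.
  have e1 w : shift_pow n w (- k%:Z + (l - n)%:Z) = w (- k%:Z + l%:Z :> int).
    by rewrite /shift_pow e.
  rewrite -e1 yn IH; [|lia|lia]; rewrite -e1; apply: zz; lia.
exists y; split => //; last first.
  move=> i ik; have -> : i = - k%:Z + (absz (i + k%:Z))%:Z by lia.
  by apply: yz; lia.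
apply: XM => i.
(* A multiple of [n] moves the window so that it starts in [[-k, n-k-1]]; as [M <= 2 * k], it stays
   where [y] and [z] agree. *)
pose q := ((i + k%:Z) %/ n%:Z)%Z.
exists (shift_pow (- (q * n%:Z)) z); first exact: shift_space_pow.
move=> l il; rewrite -[in LHS](shift_pow_period (- q) yn) /shift_pow mulNr.
have := divz_eq (i + k%:Z) n; rewrite -/q => e.
have := modz_ge0 (i + k%:Z) (_ : n%:Z != 0).
have := @ltz_pmod (i + k%:Z) n%:Z.
move: e; set s := (_ %% _)%Z; set qn := q * _ => e slt sge.
have n0' : n%:Z != 0 by lia.
have n0'' : 0 < n%:Z by lia.
have {}slt := slt n0''; have {}sge := sge n0'.
have -> : l - qn = - k%:Z + (absz (l - qn + k%:Z))%:Z by lia.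
apply: yz; lia.
Qed.

Lemma transitive_connect X k x y : shift_space X -> transitive_shift X ->
  X x -> X y ->
  exists z n, [/\ X z, (0 < n)%N, agree (- k%:Z) k z x &
    agree (- k%:Z) k (shift_pow n z) y].
Proof.
move=> sX tX Xx Xy.
have inL v : X v -> language X (block v (- k%:Z) k).
  by move=> Xv; exists v => //; exists (- k%:Z), k%:Z.
have [w _ [z' Xz' [i [j]]]] := tX _ _ (inL _ Xx) (inL _ Xy).
have bk (v : AZ) l : (l <= 2 * k)%N ->
    nth (x 0) (block v (- k%:Z) k) l = v (- k%:Z + l%:Z).
  move=> lk; rewrite /block ifT; last by lia.
  by rewrite nth_mkseq//; lia.
have sb (v : AZ) : size (block v (- k%:Z) k) = (2 * k).+1.
  by apply/eqP; rewrite -eqz_nat size_block; lia.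
have bz l : (l < size (block z' i j))%N ->
    nth (x 0) (block z' i j) l = z' (i + l%:Z).
  by rewrite /block; case: ifP => //= _; rewrite size_mkseq => ?; rewrite nth_mkseq.
move=> e; move: bz; rewrite e !size_cat !sb => bz.
(* The centres of the two words are [2 * k + 1 + size w] apart, which is positive even for empty
   [w]. *)
exists (shift_pow (i + k%:Z) z'), ((2 * k).+1 + size w)%N; split.
- exact: shift_space_pow.
- by [].
- move=> l lk; have le : l = - k%:Z + (absz (l + k%:Z))%:Z by lia.
  rewrite {2}le -(bk x); last by lia.
  rewrite /shift_pow; have := bz (absz (l + k%:Z)%R) ltac:(lia).
  rewrite nth_cat sb ifT; last by lia.
  by move=> ->; congr z'; lia.
- move=> l lk; have le : l = - k%:Z + (absz (l + k%:Z))%:Z by lia.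
  rewrite {2}le -(bk y); last by lia.
  rewrite /shift_pow.
  have := bz ((2 * k).+1 + size w + absz (l + k%:Z)%R)%N ltac:(lia).
  rewrite nth_cat sb ifF; last by lia.
  rewrite nth_cat ifF; last by lia.
  have -> : ((2 * k).+1 + size w + `|(l + k)%R| - (2 * k).+1 - size w)%N
    = absz (l + k%:Z)%R by lia.
  by move=> ->; congr z'; lia.
Qed.

End ShiftDynamics.

Lemma real_cauchy_limit (R : realType) (u : nat -> R) :
  (forall e, 0 < e -> exists N, forall n, (N <= n)%N -> `|u n - u N| <= e) ->
  exists v, forall e, 0 < e -> exists N, forall n, (N <= n)%N -> `|u n - v| <= e.
Proof.
move=> cu; have /cvg_ex[v uv] : cvgn u.
  apply/cauchy_cvgP/cauchy_exP => e e0.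
  have [N uN] := cu _ (divr_gt0 e0 (ltr0n R 2)); exists (u N).
  exists N => // n /= Nn; rewrite /ball/= distrC (le_lt_trans (uN _ Nn))//.
  by rewrite ltr_pdivrMr// ltr_pMr// ltr1n.
exists v => e e0; have /cvgrPdist_le /(_ _ e0)[N _ Nu] := uv.
by exists N => n Nn; rewrite distrC; apply: Nu.
Qed.

(** * Birkhoff sums, orbit segments and limits of return times *)

Section BirkhoffSums.
Context {R : realType} {A : finType}.
Local Notation AZ := (fullshift R A).
Implicit Types (x y z p : AZ) (X : set AZ) (a b i j m : int) (k n N : nat)
  (r : AZ -> R).

Lemma birkhoff0 r x : birkhoff r 0 x = 0.
Proof. exact: big_geq. Qed.

Lemma birkhoff1 r x : birkhoff r 1 x = r x.
Proof. by rewrite -[1]/(Posz 1) /birkhoff big_nat1 shift_pow0. Qed.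

Lemma birkhoffS r m x : birkhoff r (m + 1) x = birkhoff r m x + r (shift_pow m x).
Proof.
case: m => n; first by rewrite -PoszD addn1 /birkhoff big_nat_recr.
rewrite NegzE; case: n => [|n].
  by rewrite addNr birkhoff0 -NegzE /birkhoff big_nat1 NegzE addNr.
have -> : - n.+2%:Z + 1 = Negz n by lia.
by rewrite -NegzE /birkhoff [in RHS]big_nat_recr//= opprD -addrA NegzE addNr addr0.
Qed.

Lemma birkhoffD r m m' x :
  birkhoff r (m + m') x = birkhoff r m x + birkhoff r m' (shift_pow m x).
Proof.
(* Being an equivalence, [S] serves both the upward induction and the downward one. *)
have S m0 : birkhoff r (m + m0) x = birkhoff r m x + birkhoff r m0 (shift_pow m x)
   <-> birkhoff r (m + (m0 + 1)) x = birkhoff r m x + birkhoff r (m0 + 1) (shift_pow m x).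
  rewrite addrA !birkhoffS shift_powD addrA; split=> [->//|]; exact: addIr.
have P n : birkhoff r (m + n%:Z) x = birkhoff r m x + birkhoff r n%:Z (shift_pow m x).
  elim: n => [|n IH]; first by rewrite addr0 birkhoff0 addr0.
  by rewrite -addn1 PoszD; apply: (S _).1.
case: m' => n; first exact: P.
rewrite NegzE; elim: n => [|n IH].
  by apply: (S _).2; rewrite addNr addr0 birkhoff0 addr0.
by apply: (S _).2; have -> : - n.+2%:Z + 1 = - n.+1%:Z by lia.
Qed.

Lemma birkhoff_cohom r s g x m : (forall i, r (shift_pow i x) - s (shift_pow i x) =
    g (shift_pow (i + 1) x) - g (shift_pow i x)) ->
  birkhoff r m x - birkhoff s m x = g (shift_pow m x) - g x.
Proof.
move=> H; have S m0 : birkhoff r m0 x - birkhoff s m0 x = g (shift_pow m0 x) - g x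
   <-> birkhoff r (m0 + 1) x - birkhoff s (m0 + 1) x = g (shift_pow (m0 + 1) x) - g x.
  rewrite !birkhoffS; have := H m0; set u := birkhoff r _ _; set v := birkhoff s _ _.
  by move=> H0; split => ?; lra.
case: m => n.
  elim: n => [|n IH]; first by rewrite !birkhoff0 shift_pow0; lra.
  by rewrite -addn1 PoszD; apply: (S _).1.
rewrite NegzE; elim: n => [|n IH].
  by apply: (S _).2; rewrite addNr !birkhoff0 shift_pow0; lra.
by apply: (S _).2; have -> : - n.+2%:Z + 1 = - n.+1%:Z by lia.
Qed.

Lemma birkhoff_ge0 X r n x : shift_space X -> (forall x, X x -> 0 < r x) -> X x ->
  0 <= birkhoff r n x.
Proof.
move=> sX r0 Xx; rewrite /birkhoff; apply: sumr_ge0 => i _.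
by apply/ltW/r0; exact: shift_space_pow.
Qed.

Lemma birkhoff_gt0 X r n x : shift_space X -> (forall x, X x -> 0 < r x) -> X x ->
  (0 < n)%N -> 0 < birkhoff r n x.
Proof.
move=> sX r0 Xx; case: n => // n _; rewrite -addn1 PoszD birkhoffS.
by rewrite ltr_wpDl ?(birkhoff_ge0 _ sX)//; apply: r0; exact: shift_space_pow.
Qed.

Lemma birkhoff_period r p n N : shift_pow n p = p ->
  birkhoff r (N * n)%N p = N%:R * birkhoff r n p.
Proof.
move=> pn; elim: N => [|N IH]; first by rewrite mul0n birkhoff0 mul0r.
rewrite mulSn addnC PoszD birkhoffD IH -addn1 natrD mulrDl mul1r; congr (_ + _).
by rewrite PoszM shift_pow_period.
Qed.

Definition walters_at X r k (e : R) := forall n x y, X x -> X y ->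
  agree (- k%:Z) (n%:Z + k%:Z) x y -> `|birkhoff r n x - birkhoff r n y| < e.

Lemma waltersP X r (e : R) k0 : walters X r -> 0 < e ->
  exists2 k, (k0 <= k)%N & walters_at X r k e.
Proof.
move=> wX e0; have [k kP] := wX _ e0; exists (k0 + k)%N; first exact: leq_addr.
case=> [|n] x y Xx Xy xy; first by rewrite !birkhoff0 subrr normr0.
have := kP n.+1 isT x y Xx Xy _.
under eq_bigr do rewrite !iter_shift.
by rewrite sumrB; apply; apply/block_agree/agree_sub/xy; lia.
Qed.

Definition segment X r k x y (t : R) := exists z n,
  [/\ X z, agree (- k%:Z) k z x, agree (- k%:Z) k (shift_pow n z) y &
      birkhoff r n z = t].

Lemma segment_le X r k k' x y t : (k <= k')%N ->
  segment X r k' x y t -> segment X r k x y t.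
Proof.
move=> kk [z [n [Xz zx zy zt]]]; exists z, n; split => //.
- by apply: agree_sub zx; lia.
- by apply: agree_sub zy; lia.
Qed.

Lemma segment_agree X r k x x' y t : agree (- k%:Z) k x x' ->
  segment X r k x y t -> segment X r k x' y t.
Proof.
move=> xx [z [n [Xz zx zy zt]]]; exists z, n; split => //; exact: agree_trans xx.
Qed.

(** The segments overlap in [2 * k + 1 > M] letters around the junction and are glued there; each
    half of the result shadows its segment at scale [k], which costs less than [e]. *)
Lemma segment_trans X r M k (e : R) x y w t t' : shift_space X ->
  window_determined X M -> (M <= 2 * k)%N -> walters_at X r k e ->
  segment X r k x y t -> segment X r k y w t' ->
  exists2 t'', segment X r k x w t'' & `|t'' - (t + t')| < 2 * e.
Proof.
move=> sX XM Mk we [z1 [n1 [Xz1 z1x z1y z1t]]] [z2 [n2 [Xz2 z2y z2w z2t]]].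
have [] := @window_glue _ _ X M (n1%:Z - k%:Z) (n1%:Z + k%:Z) z1
  (shift_pow (- n1%:Z) z2) XM _ Xz1 (shift_space_pow _ sX Xz2).
- by lia.
- have /(agree_shift (m := - n1%:Z)) := agree_trans z1y (agree_sym z2y).
  by rewrite shift_powK => H; apply: agree_sub H; lia.
move=> z [Xz zz1 zz2].
have zz2' i : - k%:Z <= i -> shift_pow n1 z i = z2 i.
  by move=> ik; rewrite /shift_pow zz2; [rewrite /shift_pow; congr z2; lia|lia].
exists (birkhoff r (n1 + n2)%N z).
  exists z, (n1 + n2)%N; split => //.
  - by apply: agree_trans z1x => i ik; apply: zz1; lia.
  - apply: agree_trans z2w; rewrite PoszD -shift_powD => i ik.
    by rewrite [LHS](zz2' (i + n2%:Z))//; lia.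
rewrite PoszD birkhoffD -z1t -z2t.
have h1 : `|birkhoff r n1 z - birkhoff r n1 z1| < e.
  by apply: we => // i ik; apply: zz1; lia.
have h2 : `|birkhoff r n2 (shift_pow n1 z) - birkhoff r n2 z2| < e.
  by apply: we => //; [exact: shift_space_pow|move=> i ik; apply: zz2'; lia].
move: h1 h2; rewrite !ltr_norml; lra.
Qed.

Lemma segment_connect X r k x y : shift_space X -> transitive_shift X ->
  X x -> X y -> exists t, segment X r k x y t.
Proof.
move=> sX tX Xx Xy; have [z [n [Xz _ zx zy]]] := transitive_connect k sX tX Xx Xy.
by exists (birkhoff r n z), z, n.
Qed.

(** The closed semigroup of the overview. The integer [j] may change with the scale and the
    error. *)
Definition returns X r p (l : R) := [set v : R | forall (e : R) k, 0 < e ->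
  exists (j : int) t, segment X r k p p t /\ `|t + j%:~R * l - v| < e].

Lemma segment_period X r k p n N : X p -> shift_pow n p = p ->
  segment X r k p p (N%:R * birkhoff r n p).
Proof.
move=> Xp pn; exists p, (N * n)%N; split => //.
- by rewrite PoszM shift_pow_period.
- exact: birkhoff_period.
Qed.

(* Extending a return by copies of the periodic orbit on both sides gives
   better and better returns, whose reduced times form a Cauchy sequence. *)
Lemma return_limit X r M k (e : R) p n0 t : shift_space X ->
  window_determined X M -> walters X r -> (M <= 2 * k)%N -> walters_at X r k e ->
  X p -> (0 < n0)%N -> shift_pow n0 p = p -> segment X r k p p t ->
  exists2 v, returns X r p (birkhoff r n0 p) v & `|t - v| <= 3 * e.
Proof.
move=> sX XM wX Mk we Xp n00 pn [z [n [Xz zp zp' zt]]].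
set l := birkhoff r n0 p.
(* The point [z2] built here follows the periodic orbit, then [z] for [n] steps, then the periodic
   orbit again. *)
have [] := @window_glue _ _ X M (- k%:Z) k%:Z p z XM _ Xp Xz (agree_sym zp).
  by lia.
move=> z1 [Xz1 z1p z1z].
have [] := @window_glue _ _ X M (n%:Z - k%:Z) (n%:Z + k%:Z) z1
  (shift_pow (- n%:Z) p) XM _ Xz1 (shift_space_pow _ sX Xp).
- by lia.
- have /(agree_shift (m := - n%:Z)) := zp'; rewrite shift_powK => H i ik.
  by rewrite z1z; [apply: H; lia|lia].
move=> z2 [Xz2 z2z1 z2p].
have zl i : i <= k%:Z -> z2 i = p i by move=> ik; rewrite z2z1 ?z1p//; lia.
have zr i : - k%:Z <= i -> shift_pow n z2 i = p i.
  by move=> ik; rewrite /shift_pow z2p; [rewrite /shift_pow; congr p; lia|lia].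
have pper N i : p (i + (N * n0)%N%:Z) = p i.
  by rewrite -[in RHS](shift_pow_period N%:Z pn) PoszM.
have zlK N i : i <= (N * n0)%N%:Z + k%:Z -> shift_pow (- (N * n0)%N%:Z) z2 i = p i.
  move=> iN; rewrite /shift_pow zl; last by lia.
  by rewrite -(pper N); congr p; lia.
have zrK N i : - ((N * n0)%N%:Z + k%:Z) <= i ->
    shift_pow (N * n0)%N (shift_pow n z2) i = p i.
  by move=> iN; rewrite {1}/shift_pow zr ?pper//; lia.
(* [L N] and [Q N] are the excesses over [N * l] of the time spent on the [N] periods before and
   after the central part. *)
pose L N := birkhoff r (N * n0)%N (shift_pow (- (N * n0)%N%:Z) z2) - N%:R * l.
pose Q N := birkhoff r (N * n0)%N (shift_pow n z2) - N%:R * l.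
(* Farther out, the agreement with the periodic orbit holds at finer scales, so the Walters error
   becomes arbitrarily small. *)
have LP N J k' e' : (k' <= N * n0 + k)%N -> walters_at X r k' e' ->
    `|L (N + J)%N - L N| < e'.
  move=> k'N we'.
  have -> : L (N + J)%N - L N =
      birkhoff r (J * n0)%N (shift_pow (- ((N + J) * n0)%N%:Z) z2)
      - birkhoff r (J * n0)%N p.
    rewrite /L (birkhoff_period r J pn) -/l natrD.
    have -> : ((N + J) * n0)%N%:Z = (J * n0)%N%:Z + (N * n0)%N%:Z by lia.
    rewrite birkhoffD shift_powD.
    have -> : - ((J * n0)%N%:Z + (N * n0)%N%:Z) + (J * n0)%N%:Z = - (N * n0)%N%:Z by lia.
    by ring.
  apply: we' => //; first exact: shift_space_pow.
  by move=> i ik; apply: zlK; lia.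
have QP N J k' e' : (k' <= N * n0 + k)%N -> walters_at X r k' e' ->
    `|Q (N + J)%N - Q N| < e'.
  move=> k'N we'.
  have -> : Q (N + J)%N - Q N =
      birkhoff r (J * n0)%N (shift_pow (N * n0)%N (shift_pow n z2))
      - birkhoff r (J * n0)%N p.
    rewrite /Q (birkhoff_period r J pn) -/l natrD.
    have -> : ((N + J) * n0)%N%:Z = (N * n0)%N%:Z + (J * n0)%N%:Z by lia.
    by rewrite birkhoffD; ring.
  apply: we' => //; first by apply: shift_space_pow => //; apply: shift_space_pow.
  by move=> i ik; apply: zrK; lia.
pose u N := L N + birkhoff r n z2 + Q N.
have [e' e'0|v uv] := @real_cauchy_limit R u.
  have [k' _ we'] := waltersP 0 wX (divr_gt0 e'0 (ltr0n R 2)).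
  exists k' => N k'N; rewrite -(subnKC k'N).
  have k'n : (k' <= k' * n0 + k)%N by nia.
  move: (LP k' (N - k')%N _ _ k'n we') (QP k' (N - k')%N _ _ k'n we').
  by rewrite /u !ltr_norml ler_norml; lra.
have L0 : L 0%N = 0 by rewrite /L mul0n birkhoff0 mul0r subrr.
have Q0 : Q 0%N = 0 by rewrite /Q mul0n birkhoff0 mul0r subrr.
(* One [e] for each tail and one for replacing [z] by [z2] on the central part. *)
exists v; last first.
  rewrite -zt leNgt; apply/negP => lt.
  pose e' := (`|birkhoff r n z - v| - 3 * e) / 2.
  have e'0 : 0 < e' by rewrite /e'; lra.
  have [N Nv] := uv _ e'0; have {Nv} := Nv N (leqnn _).
  have kk : (k <= 0 * n0 + k)%N by [].
  move: (LP 0%N N _ _ kk we) (QP 0%N N _ _ kk we).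
  rewrite add0n L0 Q0 !subr0.
  have : `|birkhoff r n z2 - birkhoff r n z| < e.
    by apply: we => // i ik; rewrite z2z1 ?z1z//; lia.
  rewrite /u.
  move=> h1 h2 h3 h4.
  have : `|birkhoff r n z - v| <= 3 * e + e'.
    have -> : birkhoff r n z - v = (L N + birkhoff r n z2 + Q N - v) - L N - Q N
      - (birkhoff r n z2 - birkhoff r n z) by ring.
    apply: (le_trans (ler_normB _ _)); apply: (le_trans (lerD (ler_normB _ _) (lexx _))).
    apply: (le_trans (lerD (lerD (ler_normB _ _) (lexx _)) (lexx _))); lra.
  by rewrite /e'; lra.
move=> e' k0 e'0; have [N Nv] := uv _ (divr_gt0 e'0 (ltr0n R 2)).
(* [K] periods are kept on each side, hence the correction by [2 * K] multiples of [l]. *)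
pose K := maxn N k0; exists (- (2 * K)%N%:Z), (u K + (2 * K)%N%:R * l); split; last first.
  rewrite intrN mulNr addrK; apply: (le_lt_trans (Nv _ _)); rewrite ?leq_maxl//; lra.
apply: (@segment_le _ _ _ K); first exact: leq_maxr.
exists (shift_pow (- (K * n0)%N%:Z) z2), (K * n0 + n + K * n0)%N; split.
- exact: shift_space_pow.
- by move=> i iK; apply: zlK; nia.
- have -> : shift_pow (K * n0 + n + K * n0)%N (shift_pow (- (K * n0)%N%:Z) z2)
      = shift_pow (K * n0)%N (shift_pow n z2).
    by rewrite !shift_powD; congr (shift_pow _ z2); lia.
  by move=> i iK; apply: zrK; nia.
- rewrite !PoszD !birkhoffD !shift_powD addNr shift_pow0 addrA addNr add0r.
  by rewrite /u /L /Q natrM; ring.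
Qed.

End BirkhoffSums.

(* Only [- l] is assumed to be negative in [D]: if [delta] is the least positive
   element, then [l] must be a multiple of [delta], which gives [- delta]. *)
Lemma closed_semigroup_dichotomy (R : realType) (D : set R) (l : R) :
  (forall v, (forall e, 0 < e -> exists2 v', D v' & `|v' - v| < e) -> D v) ->
  (forall v v', D v -> D v' -> D (v + v')) -> 0 < l -> D l -> D (- l) ->
  (forall e, 0 < e -> exists2 d, D d & 0 < d < e) \/
  (exists2 delta : R, 0 < delta & forall v, D v -> exists j : int, v = j%:~R * delta).
Proof.
move=> Dcl DD l0 Dl DNl.
have [|/existsNP[e /not_implyP[e0 De]]] :=
  pselect (forall e, 0 < e -> exists2 d, D d & 0 < d < e); first by left.
right.
pose P := [set d | D d /\ 0 < d]; pose delta := inf P.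
have Pe : lbound P e.
  move=> d [Dd d0]; rewrite leNgt; apply/negP => de.
  by apply: De; exists d => //; rewrite d0.
have P0 : P !=set0 by exists l.
have Pinf : has_inf P by split => //; exists e.
have delta0 : 0 < delta by rewrite (lt_le_trans e0)// lb_le_inf.
have Dmin d : D d -> 0 < d -> delta <= d by move=> Dd d0; apply: ge_inf => //; case: Pinf.
have Ddelta : D delta.
  apply: Dcl => e' e'0; have [d [Dd d0] ltd] := inf_adherent e'0 Pinf.
  exists d => //; rewrite ger0_norm ?subr_ge0 ?Dmin//; rewrite -/delta in ltd; lra.
have D0 : D 0 by rewrite -(subrr l); exact: DD.
have Dn v n : D v -> D (n%:R * v).
  by move=> Dv; elim: n => [|n IH]; rewrite ?mul0r// -natr1 mulrDl mul1r; exact: DD.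
have DNdelta : D (- delta).
  have /truncn_itv : 0 <= l / delta by rewrite divr_ge0// ltW.
  set a := Num.trunc _ => /andP[al la].
  rewrite ler_pdivlMr// in al; rewrite ltr_pdivrMr// in la.
  (* This element is positive and at most [delta], so minimality makes it [delta] and
     [l = a * delta]. *)
  have Da : D (a.+1%:R * delta + - l) by apply: DD => //; exact: Dn.
  have := Dmin _ Da; rewrite subr_gt0 la => /(_ isT).
  rewrite -natr1 mulrDl mul1r => da.
  have la' : l = a%:R * delta by lra.
  have : (0 < a)%N.
    by rewrite lt0n; apply/negP => /eqP a0; move: la'; rewrite a0; lra.
  move: la' DNl; case: (a) => // b -> DNl _.
  have -> : - delta = b%:R * delta + - (b.+1%:R * delta) by rewrite -natr1; lra.
  by apply: DD => //; exact: Dn.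
have Dz (j : int) : D (j%:~R * delta).
  case: j => n; first exact: Dn.
  by rewrite NegzE mulrNz mulNr -mulrN; exact: Dn.
exists delta => // v Dv; exists (Num.floor (v / delta)).
have /andP[] := floor_itv (v / delta); set q := Num.floor _.
rewrite ler_pdivlMr// ltr_pdivrMr// intrD mulrDl mul1r => qv vq.
(* The remainder of [v] modulo [delta] is in [D] and in [[0, delta)]; by minimality it vanishes. *)
have Dq : D (v + (- q)%:~R * delta) by exact: DD.
have := Dmin _ Dq; rewrite mulrNz mulNr subr_gt0 => H.
apply/eqP; rewrite eq_le qv andbT leNgt; apply/negP => lt.
by have := H lt; lra.
Qed.

(** * The semigroup of return times, and its dense case *)

Section Returns.
Context {R : realType} {A : finType}.
Local Notation AZ := (fullshift R A).
Variables (X : set AZ) (r : AZ -> R) (M : nat) (p : AZ) (n0 : nat).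
Hypotheses (sX : shift_space X) (XM : window_determined X M) (wX : walters X r).
Hypotheses (Xp : X p) (pn : shift_pow n0 p = p).
Local Notation l := (birkhoff r n0 p).
Local Notation D := (returns X r p l).
Implicit Types (k : nat) (e v c t : R).

Lemma good_scale k e : 0 < e ->
  exists k', [/\ (k <= k')%N, (M <= 2 * k')%N & walters_at X r k' e].
Proof.
move=> e0; have [k' kk' wk'] := waltersP (k + M) wX e0.
by exists k'; split => //; lia.
Qed.

Lemma returnsD v v' : D v -> D v' -> D (v + v').
Proof.
move=> Dv Dv' e k e0.
have e4 : 0 < e / 4 by rewrite divr_gt0.
have [k' [kk' Mk' wk']] := good_scale k e4.
have [j [t [st tv]]] := Dv _ k' e4.
have [j' [t' [st' tv']]] := Dv' _ k' e4.
have [t'' st'' tt''] := segment_trans sX XM Mk' wk' st st'.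
exists (j + j'), t''; split; first exact: segment_le st''.
rewrite intrD mulrDl; move: tv tv' tt''; rewrite !ltr_norml; lra.
Qed.

Lemma returns_closed v :
  (forall e, 0 < e -> exists2 v', D v' & `|v' - v| < e) -> D v.
Proof.
move=> H e k e0; have e2 : 0 < e / 2 by rewrite divr_gt0.
have [v' Dv' vv'] := H _ e2; have [j [t [st tv]]] := Dv' _ k e2.
by exists j, t; split => //; move: tv vv'; rewrite !ltr_norml; lra.
Qed.

Lemma returns_period (j : int) : D (j%:~R * l).
Proof.
move=> e k e0; exists j, (0%:R * l); split; first exact: segment_period.
by rewrite mul0r add0r subrr normr0.
Qed.

Hypothesis l0 : 0 < l.

(** Dividing [c] by [l] and the remainder by [d] gives [c = a * l + i * d] up to less than [d], with
    [i] bounded. Each [i * d] is a return time modulo [l], and copies of the periodic orbit supply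
    the multiple of [l] once [a] is large. *)
Lemma dense_returns : (forall e, 0 < e -> exists2 d, D d & 0 < d < e) ->
  forall k e, 0 < e -> exists C : R, forall c, C <= c ->
    exists2 t, segment X r k p p t & `|t - c| < e.
Proof.
move=> Dd k e e0; have e8 : 0 < e / 8 by rewrite divr_gt0.
have [d Ddd /andP[d0 d8]] := Dd _ e8.
have [k' [kk' Mk' wk']] := good_scale k e8.
have Q i : exists C : nat, forall a, (C <= a)%N ->
    exists2 t, segment X r k' p p t & `|t - (i%:R * d + a%:R * l)| < e / 2.
  have Di : D (i%:R * d).
    elim: i => [|i IH]; last by rewrite -natr1 mulrDl mul1r; exact: returnsD.
    by rewrite mul0r -(mul0r l); exact: (returns_period 0).
  have [j [t [st tj]]] := Di _ k' e8.
  (* For [a >= |j|] the number [j + a] of periods to append is nonnegative, whatever the sign of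
     [j]. *)
  exists (absz j) => a ja.
  have [t' st' tt'] := segment_trans sX XM Mk' wk' st
    (segment_period r k' (absz (j + a%:Z)) Xp pn).
  exists t' => //; move: tt'.
  have -> : (absz (j + a%:Z))%:R = j%:~R + a%:R :> R.
    by rewrite !pmulrn -intrD; congr (_%:~R); lia.
  by rewrite mulrDl; move: tj; rewrite !ltr_norml; lra.
(* Finitely many [i] occur, so their thresholds can be summed into a common one. *)
have U m : exists C : nat, forall i a, (i < m)%N -> (C <= a)%N ->
    exists2 t, segment X r k' p p t & `|t - (i%:R * d + a%:R * l)| < e / 2.
  elim: m => [|m [C IH]]; first by exists 0%N.
  have [C' C'P] := Q m; exists (C + C')%N => i a.
  rewrite ltnS leq_eqVlt => /predU1P[->|im] Ca; first by apply: C'P; lia.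
  by apply: IH => //; lia.
have [C CP] := U (Num.trunc (l / d)).+1.
exists (C%:R * l) => c Cc.
have c0 : 0 <= c / l by rewrite divr_ge0// ?(ltW l0)// (le_trans _ Cc)// mulr_ge0// ltW.
have := truncn_itv c0; set a := Num.trunc (c / l).
rewrite ler_pdivlMr// ltr_pdivrMr// => /andP[ac ca].
have Ca : (C <= a)%N.
  by rewrite -ltnS -(ltr_nat R) -(ltr_pM2r l0) (le_lt_trans Cc).
pose b := c - a%:R * l.
have b0 : 0 <= b / d by rewrite divr_ge0// ?(ltW d0)// /b subr_ge0.
have := truncn_itv b0; set i := Num.trunc (b / d).
rewrite ler_pdivlMr// ltr_pdivrMr// => /andP[ib bi].
have im : (i < (Num.trunc (l / d)).+1)%N.
  rewrite ltnS; apply: le_truncn; rewrite ler_pM2r ?invr_gt0// /b.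
  by move: ca; rewrite -natr1 mulrDl mul1r; lra.
have [t st tt] := CP _ _ im Ca; exists t; first exact: segment_le st.
by move: ib bi tt; rewrite -natr1 mulrDl mul1r !ltr_norml /b; lra.
Qed.

End Returns.

(** * Cylinders as a neighbourhood basis *)

Section ShiftTopology.
Context {R : realType} {A : finType}.
Local Notation AZ := (fullshift R A).
Implicit Types (x y : AZ) (k : nat).

Lemma nbhs_agree k x : nbhs x [set y | agree (- k%:Z) k x y].
Proof.
apply/nbhs_ballP; exists (2 ^+ k)^-1; first by rewrite /= invr_gt0 exprn_gt0.
move=> y; rewrite ballEmdist /= => xy i ik; apply/eqP/negPn/negP => xyi.
have : differ_at x y (absz i).
  rewrite /differ_at; case: (leP 0 i) => i0.
    have -> : (absz i)%:Z = i by lia. by rewrite xyi.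
  by (have -> : - (absz i)%:Z = i by lia); rewrite xyi orbT.
move=> /shift_dist_ge; apply/negP; rewrite -ltNge; apply: (lt_le_trans xy).
rewrite lef_pV2 ?posrE ?exprn_gt0//; apply: ler_weXn2l; last by lia.
by rewrite ler1n.
Qed.

Lemma nbhs_cylinder x (U : set AZ) : nbhs x U ->
  exists k, forall y, agree (- k%:Z) k x y -> U y.
Proof.
move=> /nbhs_ballP[e /= e0 xU]; have [k ek] : exists k : nat, e^-1 < k%:R.
  exists (Num.trunc e^-1).+1; have /truncn_itv/andP[//] : 0 <= e^-1.
  by rewrite invr_ge0 ltW.
exists k => y xy.
apply: xU; rewrite ballEmdist /=.
suff : shift_dist x y < e by [].
rewrite /shift_dist; case: pselect => // h; case: ex_minnP => m xym _.
have km : (k < m)%N.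
  rewrite ltnNge; apply/negP => mk; move: xym.
  by rewrite /differ_at !xy ?eqxx//; lia.
rewrite -[e]invrK ltf_pV2 ?posrE ?exprn_gt0 ?invr_gt0//.
apply: lt_le_trans ek _; rewrite -natrX ler_nat; exact: leq_trans (ltnW km) (ltnW (ltn_expl _ _)).
Qed.

End ShiftTopology.

(** * Points, open sets and mixing of the suspension flow *)

Section SuspensionFlow.
Context {R : realType} {A : finType}.
Local Notation AZ := (fullshift R A).
Variables (X : set AZ) (r : AZ -> R).
Hypotheses (sX : shift_space X) (r0 : forall x, X x -> 0 < r x).
Local Notation dom := (suspension_domain X r).
Implicit Types (p q : dom) (T : R).

Lemma domP p : [/\ X (set_val p).1, 0 <= (set_val p).2 & (set_val p).2 <= r (set_val p).1].
Proof. by have [? /andP[]] := set_valP p. Qed.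

Definition same_orbit_point (p q : dom) := exists2 n : int,
  (set_val q).1 = shift_pow n (set_val p).1 &
  birkhoff r n (set_val p).1 + (set_val q).2 = (set_val p).2.

(** Heights lie between [0] and a positive roof, so two names of one point are at most one shift
    apart, and one shift is one gluing step. *)
Lemma suspension_equivP p q : suspension_equiv p q <-> same_orbit_point p q.
Proof.
split=> [/asboolP|].
  elim=> {p q} [p q [p2 q2]|p|p q _ [n qn nq]|p q s _ [n qn nq] _ [m sm ms]].
  - by exists 1; rewrite q2// birkhoff1 addr0.
  - by exists 0; rewrite ?shift_pow0 ?birkhoff0 ?add0r.
  - exists (- n); first by rewrite qn shift_powK.
    have : birkhoff r (n - n) (set_val p).1 = 0 by rewrite subrr birkhoff0.
    by rewrite birkhoffD -qn; lra.
  - exists (n + m); first by rewrite sm qn shift_powD.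
    by rewrite birkhoffD -qn; lra.
case=> n qn nq; apply/asboolP.
have pos (u v : dom) (m : nat) : (set_val v).1 = shift_pow m.+1 (set_val u).1 ->
    birkhoff r m.+1 (set_val u).1 + (set_val v).2 = (set_val u).2 -> glued u v.
  have [Xu u2 ur] := domP u; have [_ v2 _] := domP v.
  move=> vm mv; move: (mv); rewrite -addn1 addnC PoszD birkhoffD birkhoff1 => mv'.
  case: m => [|m] in vm mv mv' *.
    have v20 : (set_val v).2 = 0 by move: mv'; rewrite birkhoff0; lra.
    split; first by move: mv'; rewrite birkhoff0; lra.
    by move: vm v20; case: (set_val v) => /= ? ? -> ->.
  have := birkhoff_gt0 sX r0 (shift_space_pow 1 sX Xu) (ltn0Sn m); lra.
case: n => [[|n]|n] in qn nq.
- rewrite (_ : p = q); first exact: rst_refl.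
  apply: val_inj; rewrite [LHS]surjective_pairing [RHS]surjective_pairing.
  by move: qn nq; rewrite shift_pow0 birkhoff0 add0r => -> ->.
- exact: rst_step (pos _ _ n qn nq).
- apply/rst_sym/rst_step/(pos _ _ n); rewrite NegzE in qn nq.
    by rewrite qn shift_powD addNr shift_pow0.
  rewrite -nq qn; have : birkhoff r (- n.+1%:Z + n.+1%:Z) (set_val p).1 = 0.
    by rewrite addNr birkhoff0.
  by rewrite birkhoffD; lra.
Qed.

Lemma suspension_piP p q : suspension_pi p = suspension_pi q <-> same_orbit_point p q.
Proof. by rewrite -suspension_equivP; split=> [/eqquotP//|H]; apply/eqquotP. Qed.

Lemma flow_rel_functional T m m1 m2 :
  @flow_rel _ _ X r T m m1 -> flow_rel T m m2 -> m1 = m2.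
Proof.
move=> [p1 [q1 [n1 [-> -> qn1 e1]]]] [p2 [q2 [n2 [/suspension_piP[n pn e] -> qn2 e2]]]].
(* From [q1] back to [p1], across to [p2], forward to [q2]. *)
apply/suspension_piP; exists (- n1 + n + n2).
  rewrite qn1 shift_powD qn2 pn shift_powD; congr (shift_pow _ (set_val p1).1); lia.
have : birkhoff r (n1 + (- n1 + n + n2)) (set_val p1).1
    = birkhoff r (n + n2) (set_val p1).1 by congr (birkhoff r _ (set_val p1).1); lia.
rewrite !(birkhoffD _ n1) (birkhoffD _ n) -qn1 -pn; lra.
Qed.

Lemma suspension_flowE T m m' :
  @flow_rel _ _ X r T m m' -> suspension_flow T m = m'.
Proof.
move=> mm'; apply: xget_subset1 => // m1 m2; exact: flow_rel_functional.
Qed.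

Hypothesis wX : walters X r.

Lemma walters_continuous (e : R) : 0 < e -> exists k : nat, forall x y, X x -> X y ->
  agree (- k%:Z) k x y -> `|r x - r y| < e.
Proof.
(* The Walters estimate for [n = 1] involves coordinates up to [k + 1]. *)
move=> e0; have [k _ we] := waltersP 0 wX e0; exists k.+1 => x y Xx Xy xy.
by rewrite -(birkhoff1 r x) -(birkhoff1 r y); apply: (we 1%N) => //;
  apply: agree_sub xy; lia.
Qed.

(** Heights kept strictly below [r x] stay below the roof at nearby points, by continuity of [r]. *)
Lemma open_suspension_box (U : set (suspension X r)) : open U -> U !=set0 ->
  exists x (t0 eta : R) (k : nat), [/\ X x, 0 <= t0, 0 < eta &
    forall y t, X y -> agree (- k%:Z) k x y -> t0 <= t <= t0 + eta ->
      exists2 p : dom, set_val p = (y, t) & U (suspension_pi p)].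
Proof.
move=> + [m]; rewrite -[m]reprK; set p0 : dom := repr m => -[W oW WU] Um.
have [Xx t00 t0r] := domP p0.
have : W (set_val p0) by rewrite -[W _]/((set_val @^-1` W) p0) WU.
move: Xx t00 t0r; case: (set_val p0) => x tau /= Xx tau0 taur Wx.
have [[P Q] /= [xP tQ] PQW] : nbhs (x, tau) W by apply: open_nbhs_nbhs.
have [k1 xk1] := nbhs_cylinder xP.
move/nbhs_ballP : tQ => [eta0 /= eta00 etaQ].
have rx0 := r0 Xx.
have [t0 [eta [t00 eta0' tr near]]] : exists t0 eta : R, [/\ 0 <= t0, 0 < eta,
    t0 + eta < r x & forall t, t0 <= t <= t0 + eta -> `|tau - t| < eta0].
  (* For a representative on the roof the interval is taken just below it; otherwise it starts at
     [tau]. *)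
  move: taur; rewrite le_eqVlt => /predU1P[taur|taur].
    pose mu := Num.min eta0 (r x) / 2.
    have mu0 : 0 < mu by rewrite divr_gt0// lt_min eta00.
    have [mu1 mu2] : mu < eta0 /\ mu < r x.
      by rewrite /mu; case: (leP eta0 (r x)) => ?; lra.
    exists (r x - mu), (mu / 2); split; [lra|lra|lra|].
    by move=> t tt; rewrite ltr_norml; lra.
  pose mu := Num.min eta0 (r x - tau) / 2.
  have mu0 : 0 < mu by rewrite divr_gt0// lt_min eta00 subr_gt0.
  have [mu1 mu2] : mu < eta0 /\ mu < r x - tau.
    by rewrite /mu; case: (leP eta0 (r x - tau)) => ?; lra.
  exists tau, mu; split; [lra|lra|lra|].
  by move=> t tt; rewrite ltr_norml; lra.
have [|k2 k2P] := @walters_continuous (r x - (t0 + eta)); first by rewrite subr_gt0.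
exists x, t0, eta, (k1 + k2)%N; split => // y t Xy xy tt.
have ryt : 0 <= t <= r y.
  have := k2P _ _ Xx Xy (agree_leq (leq_addl k1 k2) xy).
  by rewrite ltr_norml; lra.
pose p : dom := exist _ (y, t) (mem_set (conj Xy ryt)).
exists p => //.
rewrite -[U _]/((\pi_(suspension X r) @^-1` U)%qT p) -WU.
apply: PQW; split => /=; first exact/xk1/(agree_leq (leq_addr k2 k1) xy).
by apply: etaQ; apply: near.
Qed.

Lemma dense_returns_mixing (M : nat) x0 (n0 : nat) :
  window_determined X M -> transitive_shift X -> X x0 -> (0 < n0)%N ->
  shift_pow n0 x0 = x0 ->
  (forall e, 0 < e -> exists2 d, returns X r x0 (birkhoff r n0 x0) d & 0 < d < e) ->
  topologically_mixing X r.
Proof.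
move=> XM tX Xx0 n00 xn Dd U V oU oV U0 V0.
have [x [tx [ex [kx [Xx tx0 ex0 xU]]]]] := open_suspension_box oU U0.
have [y [ty [ey [ky [Xy ty0 ey0 yV]]]]] := open_suspension_box oV V0.
(* One return and two gluings cost less than [e + 2 * e + 2 * e], which is [ey / 2] for
   [e = ey / 10]. *)
have e0 : 0 < ey / 10 by rewrite divr_gt0.
have [k [kk Mk wk]] := good_scale M wX (kx + ky) e0.
have [t1 s1] := segment_connect r k sX tX Xx Xx0.
have [t2 s2] := segment_connect r k sX tX Xx0 Xy.
have l0 : 0 < birkhoff r n0 x0 by exact: birkhoff_gt0 sX r0 Xx0 n00.
have [C CP] := dense_returns sX XM wX Xx0 xn l0 Dd k e0.
exists (C + t1 + t2 - tx + ty + ey / 2) => t tC.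
(* The return time that would lead exactly to height [ty + ey / 2], the middle of the interval for
   [V]. *)
have [|s ss sc] := CP (t + tx - ty - ey / 2 - t1 - t2); first by lra.
have [s' ss' sc'] := segment_trans sX XM Mk wk s1 ss.
have [s'' [z [n [Xz zx zy zs]]] sc''] := segment_trans sX XM Mk wk ss' s2.
have [||p1 p1z p1U] := xU z tx Xz.
- exact/agree_sym/(agree_leq (leq_trans (leq_addr _ _) kk) zx).
- by rewrite lexx lerDl ltW.
have [||p2 p2z p2V] := yV (shift_pow n z) (t + tx - s'') (shift_space_pow n sX Xz).
- exact/agree_sym/(agree_leq (leq_trans (leq_addl _ _) kk) zy).
- by move: sc sc' sc''; rewrite !ltr_norml; lra.
exists (suspension_pi p2); split => //; exists (suspension_pi p1) => //.
apply: suspension_flowE; exists p1, p2, n; split => //; first by rewrite p1z p2z.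
by rewrite p1z p2z /= -/(birkhoff r n z) zs; lra.
Qed.

End SuspensionFlow.

(** * Real numbers close to the lattice [delta * Z] *)

Section NearLattice.
Context {R : realType}.
Variables (delta : R).
Hypothesis delta0 : 0 < delta.
Implicit Types (e c t : R) (i j : int).

Definition near_lattice e t := exists j : int, `|t - j%:~R * delta| <= e.

Lemma near_latticeB e e' t t' :
  near_lattice e t -> near_lattice e' t' -> near_lattice (e + e') (t - t').
Proof.
move=> [j tj] [j' tj']; exists (j - j'); rewrite intrB mulrBl.
have -> : t - t' - (j%:~R * delta - j'%:~R * delta) =
  (t - j%:~R * delta) - (t' - j'%:~R * delta) by ring.
by rewrite (le_trans (ler_normB _ _))// lerD.
Qed.

Lemma near_lattice_shift e t t' j : t = t' + j%:~R * delta ->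
  near_lattice e t' -> near_lattice e t.
Proof.
by move=> -> [i ti]; exists (i + j); rewrite intrD mulrDl opprD addrACA subrr addr0.
Qed.

Lemma near_lattice_approx e e' t t' : near_lattice e t -> `|t - t'| <= e' ->
  near_lattice (e + e') t'.
Proof.
move=> [j tj] tt'; exists j.
have -> : t' - j%:~R * delta = (t - j%:~R * delta) - (t - t') by ring.
by rewrite (le_trans (ler_normB _ _))// lerD.
Qed.

Lemma lattice_small j : `|j%:~R * delta| < delta -> j = 0.
Proof.
rewrite normrM (gtr0_norm delta0) gtr_pMl// -intr_norm -(mulr1z 1) ltr_int.
by lia.
Qed.

(** The lattice point near [t] has absolute value below [delta], so it is [0]. This turns estimates
    modulo [delta] into genuine ones. *)
Lemma near_lattice_small e c t : near_lattice e t -> `|t| <= c -> e + c < delta ->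
  `|t| <= e.
Proof.
move=> [j tj] tc ec; have j0 : j = 0.
  apply: lattice_small; apply: le_lt_trans ec.
  have -> : j%:~R * delta = t - (t - j%:~R * delta) by ring.
  by rewrite (addrC e) (le_trans (ler_normB _ _))// lerD.
by move: tj; rewrite j0 mul0r subr0.
Qed.

Lemma near_lattice_exact t : (forall e, 0 < e -> near_lattice e t) ->
  exists j : int, t = j%:~R * delta.
Proof.
(* The lattice point is fixed at precision [delta / 4]; its distance to [t] is then shown to be
   below every [e]. *)
move=> H; have d4 : 0 < delta / 4 by rewrite divr_gt0.
have [j tj] := H _ d4; exists j; apply/eqP; rewrite -subr_eq0 -normr_le0.
apply/ler_addgt0Pl => e e0; rewrite addr0.
have m0 : 0 < Num.min e (delta / 4) by rewrite lt_min e0.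
apply: (@le_trans _ _ (Num.min e (delta / 4))); last by rewrite ge_min lexx.
apply: (near_lattice_small _ tj); last first.
  have : Num.min e (delta / 4) <= delta / 4 by rewrite ge_min lexx orbT.
  by lra.
apply: (near_lattice_shift (j := - j) (t' := t)); last exact: H.
by rewrite mulrNz mulNr.
Qed.

End NearLattice.

(** * Central words and uniform continuity on [X] *)

Section Words.
Context {R : realType} {A : finType}.
Local Notation AZ := (fullshift R A).
Implicit Types (X : set AZ) (x y : AZ) (k : nat) (f g : AZ -> R).

(** Encoded as a finite function so that the words of radius [k] form a finite type, for pigeonhole
    and finite sums. *)
Definition word k x : {ffun 'I_(2 * k).+1 -> A} := [ffun i : 'I_(2 * k).+1 => x (i%:Z - k%:Z)].

Lemma wordP k x y : word k x = word k y <-> agree (- k%:Z) k x y.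
Proof.
split=> [/ffunP xy i ik|xy]; last by apply/ffunP => i; rewrite !ffunE xy//; move: (ltn_ord i); lia.
have ik' : (absz (i + k%:Z)%R < (2 * k).+1)%N by lia.
have := xy (Ordinal ik'); rewrite !ffunE /=.
by have -> : (absz (i + k%:Z)%R)%:Z - k%:Z = i by lia.
Qed.

Definition cylinder_continuous X f := forall e : R, 0 < e ->
  exists k, forall x y, X x -> X y -> agree (- k%:Z) k x y -> `|f x - f y| < e.

Lemma cylinder_continuous_within X f :
  cylinder_continuous X f -> {within X, continuous f}.
Proof.
move=> fc; apply/subspace_continuousP => x Xx; apply/cvgrPdist_lt => e e0.
have [k kP] := fc _ e0; rewrite near_withinE.
by apply: filterS (nbhs_agree k x) => y xy Xy; exact: kP.
Qed.

Lemma cylinder_continuous_bounded X f : cylinder_continuous X f ->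
  exists B : R, forall x, X x -> `|f x| <= B.
Proof.
move=> fc; have [k kP] := fc _ (@ltr01 R).
(* One value of [f] for each word that occurs in [X], and [0] for the others. *)
pose c w := xget 0 [set t : R | exists2 y, X y & word k y = w /\ t = f y].
exists (\sum_w `|c w| + 1) => x Xx.
have [y Xy [/wordP yx cy]] : [set t : R | exists2 y, X y &
    word k y = word k x /\ t = f y] (c (word k x)).
  by apply: xgetPex; exists (f x), x.
have fxy := kP _ _ Xx Xy (agree_sym yx).
apply: (@le_trans _ _ (`|c (word k x)| + 1)).
  have -> : f x = f y + (f x - f y) by ring.
  by rewrite cy (le_trans (ler_normD _ _))// lerD// ltW.
by rewrite lerD2r (bigD1 (word k x))//= lerDl sumr_ge0.
Qed.

End Words.

(** * The lattice case: construction of the transfer function *)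

Section TransferFunction.
Context {R : realType} {A : finType}.
Local Notation AZ := (fullshift R A).
Variables (X : set AZ) (r : AZ -> R) (M : nat) (p : AZ) (n0 : nat) (delta : R).
Hypotheses (sX : shift_space X) (tX : transitive_shift X).
Hypotheses (XM : window_determined X M) (wX : walters X r).
Hypotheses (Xp : X p) (n00 : (0 < n0)%N) (pn : shift_pow n0 p = p).
Hypothesis delta0 : 0 < delta.
Hypothesis returns_lattice : forall v, returns X r p (birkhoff r n0 p) v ->
  exists j : int, v = j%:~R * delta.
Local Notation near := (near_lattice delta).
Implicit Types (k : nat) (e v t : R) (x y : AZ).

Lemma return_near e : 0 < e -> exists k, forall t, segment X r k p p t -> near e t.
Proof.
move=> e0; have e3 : 0 < e / 3 by rewrite divr_gt0.
have [k [_ Mk wk]] := good_scale M wX 0 e3; exists k => t st.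
have [v /returns_lattice[j vj] tv] := return_limit sX XM wX Mk wk Xp n00 pn st.
by exists j; rewrite -vj (le_trans tv)//; lra.
Qed.

(** Preceded by one common segment from [p] to [x], both segments become returns, whose times are
    near the lattice; the common time cancels. *)
Lemma tail_near e : 0 < e -> exists k, forall x t t', X x ->
  segment X r k x p t -> segment X r k x p t' -> near e (t - t').
Proof.
move=> e0; have e8 : 0 < e / 8 by rewrite divr_gt0.
have e4 : 0 < e / 4 by rewrite divr_gt0.
have [k1 k1P] := return_near e4.
have [k [k1k Mk wk]] := good_scale M wX k1 e8; exists k => x t t' Xx st st'.
have [s ss] := segment_connect r k sX tX Xp Xx.
have [u /(segment_le k1k)/k1P nu us] := segment_trans sX XM Mk wk ss st.
have [u' /(segment_le k1k)/k1P nu' us'] := segment_trans sX XM Mk wk ss st'.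
have -> : e = (e / 4 + e / 4) + e / 2 by lra.
apply: near_lattice_approx (near_latticeB nu nu') _.
by move: us us'; rewrite !ltr_norml ler_norml; lra.
Qed.

(** [v] represents the limit modulo [delta] of the times from [x] to [p]. *)
Definition tail_value x v := forall e, 0 < e ->
  exists k, forall t, segment X r k x p t -> near e (t - v).

Lemma tail_valueP k0 x t0 : X x ->
  (forall x t t', X x -> segment X r k0 x p t -> segment X r k0 x p t' ->
    near (delta / 8) (t - t')) ->
  segment X r k0 x p t0 -> exists2 v, tail_value x v & `|v - t0| <= delta / 8.
Proof.
move=> Xx k0P st0.
(* Moving each time by a lattice element to within [delta / 8] of [t0] turns convergence modulo
   [delta] into convergence. *)
have /choice[u uP] : forall k, exists u : R, (exists j : int,
    segment X r (k + k0) x p (u + j%:~R * delta)) /\ `|u - t0| <= delta / 8.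
  move=> k; have [t st] := segment_connect r (k + k0) sX tX Xx Xp.
  have [j tj] := k0P _ _ _ Xx (segment_le (leq_addl _ _) st) st0.
  exists (t - j%:~R * delta); split; first by exists j; rewrite subrK.
  by rewrite addrAC.
have [e e0|v uv] := @real_cauchy_limit R u.
  have m0 : 0 < Num.min e (delta / 4) by rewrite lt_min e0 divr_gt0.
  have [k kP] := tail_near m0; exists k => n kn.
  have [[j sj] uj] := uP k; have [[i si] ui] := uP n.
  apply: (@le_trans _ _ (Num.min e (delta / 4))); last by rewrite ge_min lexx.
  have nn := kP _ _ _ Xx (segment_le (leq_trans kn (leq_addr _ _)) si)
    (segment_le (leq_addr _ _) sj).
  apply: (near_lattice_small delta0 (c := delta / 4)).
  - apply: (near_lattice_shift (j := j - i)) nn.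
    by rewrite intrB mulrBl; ring.
  - by move: ui uj; rewrite !ler_norml; lra.
  - have : Num.min e (delta / 4) <= delta / 4 by rewrite ge_min lexx orbT.
    by move: delta0; lra.
exists v.
  move=> e e0; have e2 : 0 < e / 2 by rewrite divr_gt0.
  have [k kP] := tail_near e2; have [N Nv] := uv _ e2.
  pose m := (k + N)%N; have [[j sj] uj] := uP m.
  exists (m + k0)%N => t st.
  have km : (k <= m + k0)%N by rewrite /m -addnA leq_addr.
  have nn := kP _ _ _ Xx (segment_le km st) (segment_le km sj).
  have -> : e = e / 2 + e / 2 by lra.
  apply: near_lattice_approx (near_lattice_shift (j := j) (t := t - u m) _ nn) _.
    by ring.
  have := Nv m (leq_addl _ _); rewrite !ler_norml; lra.
apply/ler_addgt0Pl => e e0; have [N Nv] := uv _ e0.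
have := Nv N (leqnn _); have [_] := uP N; rewrite !ler_norml; lra.
Qed.

(** The scale in [tail_value] depends on [x]; comparison with a segment at a finer scale allows a
    [k] uniform in [x]. *)
Lemma tail_value_near e k x v : X x -> tail_value x v -> 0 < e ->
  (forall x t t', X x -> segment X r k x p t -> segment X r k x p t' ->
    near e (t - t')) ->
  forall t, segment X r k x p t -> near (2 * e) (t - v).
Proof.
move=> Xx xv e0 kP t st; have [k' k'P] := xv _ e0.
have [t' st'] := segment_connect r (k + k') sX tX Xx Xp.
have n1 := kP _ _ _ Xx st (segment_le (leq_addr _ _) st').
have [j n2] := k'P _ (segment_le (leq_addl _ _) st').
have -> : 2 * e = e + e by lra.
have n1' := near_lattice_shift (j := j) erefl n1.
by apply: near_lattice_approx n1' _; move: n2; rewrite !ler_norml; lra.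
Qed.

(** Dropping the first step of a segment from [x] to [p] gives one from [left_shift x], shorter by
    almost [r x], at a scale smaller by one. *)
Lemma tail_value_lattice x v v' : X x -> tail_value x v ->
  tail_value (left_shift x) v' -> exists j : int, r x + v' - v = j%:~R * delta.
Proof.
move=> Xx xv xv'; apply: near_lattice_exact => // e e0.
have e4 : 0 < e / 4 by rewrite divr_gt0.
have [k kP] := xv _ e4; have [k' k'P] := xv' _ e4.
have [k'' k''P] := walters_continuous wX e4.
pose m := (k + k' + k'')%N.
have [z [n [Xz n_gt0 zx zp]]] := transitive_connect m.+1 sX tX Xx Xp.
case: n n_gt0 zp => // n _ zp.
have km : (k <= m.+1)%N by rewrite /m; lia.
have k'm : (k' <= m)%N by rewrite /m; lia.
have k''m : (k'' <= m.+1)%N by rewrite /m; lia.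
have s1 : segment X r m.+1 x p (birkhoff r n.+1 z) by exists z, n.+1.
have s2 : segment X r m (left_shift x) p (birkhoff r n (left_shift z)).
  exists (left_shift z), n; split => //; first exact: shift_space_pow.
    by have := agree_shift (m := 1) zx; apply: agree_sub; lia.
  rewrite /left_shift shift_powD -PoszD add1n.
  by apply: agree_leq zp.
have bz : birkhoff r n.+1 z = r z + birkhoff r n (left_shift z).
  by rewrite -add1n PoszD birkhoffD birkhoff1.
have n1 := kP _ (segment_le km s1); have n2 := k'P _ (segment_le k'm s2).
have rz := k''P _ _ Xz Xx (agree_leq k''m zx).
have -> : e = (e / 4 + e / 4) + e / 2 by lra.
apply: near_lattice_approx (near_latticeB n1 n2) _.
rewrite bz; move: rz; rewrite ltr_norml ler_norml; lra.
Qed.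

Lemma transfer_function : exists2 g : AZ -> R, cylinder_continuous X g &
  forall x, X x -> exists j : int, r x + g (left_shift x) - g x = j%:~R * delta.
Proof.
have d8 : 0 < delta / 8 by rewrite divr_gt0.
have [k0 k0P] := tail_near d8.
(* One reference time per word selects the lifts consistently: on a cylinder of radius [k0], values
   of [g] differ by at most [delta / 4]. *)
pose c w := xget 0 [set t : R | exists2 x, X x & word k0 x = w /\ segment X r k0 x p t].
have cP x : X x -> segment X r k0 x p (c (word k0 x)).
  move=> Xx; have [y Xy [/wordP yx]] : [set t : R | exists2 y, X y &
      word k0 y = word k0 x /\ segment X r k0 y p t] (c (word k0 x)).
    apply: xgetPex; have [t st] := segment_connect r k0 sX tX Xx Xp.
    by exists t, x.
  exact: segment_agree.
have /choice[g gP] : forall x, exists v, X x ->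
    tail_value x v /\ `|v - c (word k0 x)| <= delta / 8.
  move=> x; have [Xx|nXx] := pselect (X x); last by exists 0.
  by have [v xv vc] := tail_valueP Xx k0P (cP x Xx); exists v.
exists g => [e e0|x Xx]; last first.
  have Xsx : X (left_shift x) by exact: shift_space_pow.
  exact: tail_value_lattice (gP _ Xx).1 (gP _ Xsx).1.
(* A segment from [x] also starts near [y], so [g x - g y] is within [4 * m] of the lattice;
   [4 * m <= delta / 2] forces the lattice point [0], and [4 * m <= e / 2] gives continuity. *)
pose m := Num.min (e / 8) (delta / 8).
have m0 : 0 < m by rewrite lt_min !divr_gt0.
have [me md] : m <= e / 8 /\ m <= delta / 8 by rewrite !ge_min !lexx orbT.
have [k kP] := tail_near m0; exists (k + k0)%N => x y Xx Xy xy.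
have [t st] := segment_connect r k sX tX Xx Xp.
have nx := tail_value_near Xx (gP _ Xx).1 m0 kP st.
have ny := tail_value_near Xy (gP _ Xy).1 m0 kP
  (segment_agree (agree_leq (leq_addr _ _) xy) st).
have /wordP wxy := agree_leq (leq_addl k k0) xy.
have := near_latticeB ny nx.
have -> : t - g y - (t - g x) = g x - g y by ring.
move=> nxy; have := near_lattice_small delta0 (c := delta / 4) nxy.
have [_ gx] := gP _ Xx; have [_ gy] := gP _ Xy; rewrite wxy in gx.
move: gx gy; rewrite !ler_norml => gx gy H.
have [||h1 h2] := andP (H _ _); [lra|lra|].
by rewrite ltr_norml; lra.
Qed.

End TransferFunction.

(** * From a lattice-valued function to a positive locally constant roof *)

Section Positivity.
Context {R : realType} {A : finType}.
Local Notation AZ := (fullshift R A).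
Variables (X : set AZ) (r g : AZ -> R) (M : nat) (delta : R).
Hypotheses (sX : shift_space X) (XM : window_determined X M).
Hypotheses (wX : walters X r) (r0 : forall x, X x -> 0 < r x).
Hypotheses (delta0 : 0 < delta) (gX : cylinder_continuous X g).
Let f x := r x + g (left_shift x) - g x.
Hypothesis fX : forall x, X x -> exists j : int, f x = j%:~R * delta.
Implicit Types (x y : AZ) (k n : nat).

Lemma cohomologous_birkhoff x (m : int) :
  birkhoff r m x - birkhoff f m x = g x - g (shift_pow m x).
Proof.
rewrite (@birkhoff_cohom _ _ r f (fun x => - g x)); first by rewrite opprK addrC.
by move=> i; rewrite /f left_shift_pow shift_powD; ring.
Qed.

Lemma birkhoff_lattice n x : X x -> exists j : int, birkhoff f n x = j%:~R * delta.
Proof.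
move=> Xx; elim: n => [|n [j IH]]; first by exists 0; rewrite birkhoff0 mul0r.
have [i fi] := fX (shift_space_pow n sX Xx).
by exists (j + i); rewrite -addn1 PoszD birkhoffS IH fi intrD mulrDl.
Qed.

(** Each of the three terms of [f] varies by less than [delta / 3], while distinct values of [f]
    differ by at least [delta]. *)
Lemma lattice_locally_constant : exists k, forall x y, X x -> X y ->
  agree (- k%:Z) k x y -> f x = f y.
Proof.
have d3 : 0 < delta / 3 by rewrite divr_gt0.
have [k1 k1P] := walters_continuous wX d3; have [k2 k2P] := gX d3.
exists (k1 + k2).+1 => x y Xx Xy xy.
have rxy : `|r x - r y| < delta / 3.
  by apply: k1P => //; apply: agree_leq xy; lia.
have gxy : `|g x - g y| < delta / 3.
  by apply: k2P => //; apply: agree_leq xy; lia.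
have gsxy : `|g (left_shift x) - g (left_shift y)| < delta / 3.
  apply: k2P => //; try exact: shift_space_pow.
  by have := agree_shift (m := 1) xy; apply: agree_sub; lia.
have [j fj] := fX Xx; have [i fi] := fX Xy.
have : j - i = 0.
  apply: (lattice_small delta0); rewrite intrB mulrBl -fj -fi /f.
  by move: rxy gxy gsxy; rewrite !ltr_norml; lra.
by move/eqP; rewrite subr_eq0 fj fi => /eqP ->.
Qed.

Lemma birkhoff_locally_constant k : (forall x y, X x -> X y ->
    agree (- k%:Z) k x y -> f x = f y) ->
  forall n x y, X x -> X y -> agree (- k%:Z) (n%:Z + k%:Z) x y ->
    birkhoff f n x = birkhoff f n y.
Proof.
move=> kP; elim=> [|n IH] x y Xx Xy xy; first by rewrite !birkhoff0.
rewrite -addn1 PoszD !birkhoffS (IH x y)//; last by apply: agree_sub xy; lia.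
congr (_ + _); apply: kP; try exact: shift_space_pow.
by have := agree_shift (m := n%:Z) xy; apply: agree_sub; lia.
Qed.

(* Among sufficiently many consecutive points of an orbit two share a long
   central word; closing up the orbit segment between them gives a periodic
   point, whose period under [r] is a positive multiple of [delta]. *)
Lemma birkhoff_uniform_lower_bound :
  exists2 L, (0 < L)%N & forall x, X x -> delta / 2 <= birkhoff r L x.
Proof.
have d2 : 0 < delta / 2 by rewrite divr_gt0.
have [k1 k1P] := lattice_locally_constant; have [k2 k2P] := gX d2.
pose k := (k1 + k2 + M)%N.
have kP x y : X x -> X y -> agree (- k%:Z) k x y -> f x = f y.
  by move=> Xx Xy xy; apply: k1P => //; apply: agree_leq xy; rewrite /k; lia.
have gP x y : X x -> X y -> agree (- k%:Z) k x y -> `|g x - g y| < delta / 2.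
  by move=> Xx Xy xy; apply: k2P => //; apply: agree_leq xy; rewrite /k; lia.
have Mk : (M <= 2 * k)%N by rewrite /k; lia.
clearbody k.
(* The number of words of radius [k]: [L + 1] consecutive points cannot have distinct ones. *)
pose L := #|{: {ffun 'I_(2 * k).+1 -> A}}|.
have bound x : X x -> delta / 2 <= birkhoff r L x.
  move=> Xx; have : ~~ injectiveb (fun i : 'I_L.+1 => word k (shift_pow i%:Z x)).
    apply/negP => /injectiveP /leq_card; rewrite card_ord -/L.
    by rewrite ltnn.
  move=> /injectivePn[i [j ij wij]].
  have {ij wij} [a [n [n_gt0 anL wan]]] : exists a n, [/\ (0 < n)%N, (a + n <= L)%N &
      word k (shift_pow a%:Z x) = word k (shift_pow (a + n)%N%:Z x)].
    have iL := ltn_ord i; have jL := ltn_ord j.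
    case: (ltngtP i j) => [lt|lt|/val_inj e]; last by rewrite e eqxx in ij.
      by exists i, (j - i)%N; rewrite subn_gt0 lt (subnKC (ltnW lt)).
    by exists j, (i - j)%N; rewrite subn_gt0 lt (subnKC (ltnW lt)).
  pose y := shift_pow a%:Z x; have Xy : X y by exact: shift_space_pow.
  have yn : agree (- k%:Z) k y (shift_pow n y).
    by apply/wordP; rewrite /y shift_powD -PoszD.
  have [z [Xz zn zy]] := window_closing sX XM Mk n_gt0 Xy yn.
  (* Over a period the coboundary vanishes, so the sum of [f] equals that of [r]: a positive element
     of the lattice. *)
  have bz : delta <= birkhoff f n z.
    have e : birkhoff r n z = birkhoff f n z.
      by apply/eqP; rewrite -subr_eq0 cohomologous_birkhoff zn subrr.
    have := birkhoff_gt0 sX r0 Xz n_gt0; rewrite e.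
    have [j' ->] := birkhoff_lattice n Xz.
    rewrite pmulr_lgt0// ltr0z => j0.
    rewrite ler_peMl ?(ltW delta0)// -(mulr1z 1) ler_int; lia.
  have bzy : birkhoff f n y = birkhoff f n z.
    by apply: (birkhoff_locally_constant kP) => //; exact: agree_sym zy.
  (* Back on [y], the coboundary costs less than [delta / 2], as both ends share their central
     word. *)
  have ry : delta / 2 <= birkhoff r n y.
    have := cohomologous_birkhoff y n.
    have := gP _ _ Xy (shift_space_pow n sX Xy) yn.
    by rewrite bzy ltr_norml; lra.
  have -> : L%:Z = a%:Z + (n%:Z + (L - (a + n))%N%:Z) by lia.
  rewrite !birkhoffD -/y.
  have := birkhoff_ge0 a sX r0 Xx.
  have := birkhoff_ge0 (L - (a + n))%N sX r0 (shift_space_pow n sX Xy).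
  by lra.
exists L => //; have [[x Xx] _ _] := sX.
rewrite lt0n; apply/eqP => L0; have := bound _ Xx.
by rewrite L0 birkhoff0; lra.
Qed.

(** Sums of [r] grow linearly and differ from those of [f] by at most [2 * B], where [B] bounds
    [|g|]. *)
Lemma birkhoff_lattice_gt0 :
  exists2 N, (0 < N)%N & forall x, X x -> 0 < birkhoff f N x.
Proof.
have [L L0 LP] := birkhoff_uniform_lower_bound.
have [B BP] := cylinder_continuous_bounded gX.
have mP m x : X x -> m%:R * (delta / 2) <= birkhoff r (m * L)%N x.
  elim: m x => [|m IH] x Xx; first by rewrite mul0n birkhoff0 mul0r.
  rewrite mulSn PoszD birkhoffD -nat1r mulrDl mul1r lerD ?LP//.
  by apply: IH; exact: shift_space_pow.
have [m m0 mB] : exists2 m, (0 < m)%N & 2 * B < m%:R * (delta / 2).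
  have B0 : 0 <= B by have [[x Xx] _ _] := sX; apply: le_trans (BP _ Xx).
  have d2 : 0 < delta / 2 by rewrite divr_gt0.
  have /truncn_itv/andP[_] : 0 <= (2 * B) / (delta / 2).
    by rewrite divr_ge0 ?mulr_ge0// ltW.
  by rewrite ltr_pdivrMr//; exists (Num.trunc (2 * B / (delta / 2))).+1.
exists (m * L)%N; first by rewrite muln_gt0 m0.
move=> x Xx; have := cohomologous_birkhoff x (m * L)%N; have := mP m x Xx.
have := BP _ Xx; have := BP _ (shift_space_pow (m * L)%N sX Xx).
by rewrite !ler_norml; lra.
Qed.

(* Averaging [f] along its orbits makes it positive, at the cost of replacing
   [delta] by [delta / N]. *)
Lemma positive_lattice_roof : exists2 delta' : R, 0 < delta' &
  exists s : AZ -> R,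
    [/\ forall x, X x -> exists2 n : nat, (0 < n)%N & s x = delta' * n%:R,
        locally_constant X s & cohomologous X r s].
Proof.
have [N N0 NP] := birkhoff_lattice_gt0.
have [k kP] := lattice_locally_constant.
have N0' : 0 < N%:R :> R by rewrite ltr0n.
have fN n x y : (n <= N)%N -> X x -> X y -> agree (- (N + k)%N%:Z) (N + k)%N x y ->
    birkhoff f n x = birkhoff f n y.
  move=> nN Xx Xy xy; apply: (birkhoff_locally_constant kP) => //.
  by apply: agree_sub xy; lia.
exists (delta / N%:R); first by rewrite divr_gt0.
exists (fun x => birkhoff f N x / N%:R); split.
- move=> x Xx; have := NP _ Xx; have [j ->] := birkhoff_lattice N Xx.
  rewrite pmulr_lgt0// ltr0z; case: j => // n n0; exists n => //.
  by rewrite -[n%:~R]pmulrn (mulrC _ delta) mulrAC.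
- move=> x Xx; exists [set y | agree (- (N + k)%N%:Z) (N + k)%N x y].
    exact: nbhs_agree.
  by move=> y xy Xy; congr (_ / _); apply: fN => //; exact: agree_sym.
(* The term [- g] accounts for [r - f], the mean of the partial sums for [f - s]. *)
- exists (fun x => - g x - (\sum_(0 <= i < N) birkhoff f i x) / N%:R).
    apply: cylinder_continuous_within => e e0; have [k' k'P] := gX e0.
    exists (N + k + k')%N => x y Xx Xy xy.
    have -> : \sum_(0 <= i < N) birkhoff f i x = \sum_(0 <= i < N) birkhoff f i y.
      apply: eq_big_nat => i /andP[_ iN]; apply: fN => //; first exact: ltnW.
      by apply: agree_leq xy; exact: leq_addr.
    set S := _ / _; have -> : - g x - S - (- g y - S) = g y - g x by ring.
    by apply: k'P => //; apply: agree_leq (agree_sym xy); exact: leq_addl.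
  move=> x Xx.
  have e n : \sum_(0 <= i < n) birkhoff f i (left_shift x)
      = \sum_(0 <= i < n) birkhoff f i x + birkhoff f n x - n%:R * f x.
    elim: n => [|n IH]; first by rewrite !big_geq// birkhoff0 mul0r subr0 addr0.
    have rec (F : nat -> R) : \sum_(0 <= i < n.+1) F i = \sum_(0 <= i < n) F i + F n.
      by rewrite big_nat_recr.
    rewrite !rec IH.
    have : birkhoff f n.+1 x = f x + birkhoff f n (left_shift x).
      by rewrite -add1n PoszD birkhoffD birkhoff1.
    rewrite -natr1 mulrDl mul1r => E.
    by rewrite E; ring.
  rewrite e /f; field; exact: lt0r_neq0.
Qed.

End Positivity.

Theorem theorem3p4 (R : realType) (A : finType) (X : set (fullshift R A))
    (r : fullshift R A -> R) :
  shift_space X ->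
  finite_type X ->
  transitive_shift X ->
  (forall x, X x -> 0 < r x) ->
  walters X r ->
  ~ topologically_mixing X r ->
  exists2 delta : R, 0 < delta &
  exists s : fullshift R A -> R,
    [/\ forall x, X x -> exists2 n : nat, (0 < n)%N & s x = delta * n%:R,
        locally_constant X s &
        cohomologous X r s].
Proof.
move=> sX /finite_type_window[M XM] tX r0 wX not_mixing.
have [[x Xx] _ _] := sX.
(* A point that returns close to its start is closed up into the periodic point [p]. *)
have [z [n [Xz n0 zx zx']]] := transitive_connect M sX tX Xx Xx.
have MM : (M <= 2 * M)%N by rewrite leq_pmull.
have [p [Xp pn _]] := window_closing sX XM MM n0 Xz (agree_trans zx (agree_sym zx')).
have l0 := birkhoff_gt0 sX r0 Xp n0.
have [|||||dense|[delta delta0 lattice]] :=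
    @closed_semigroup_dichotomy R (returns X r p (birkhoff r n p)) (birkhoff r n p).
- exact: returns_closed.
- by move=> v v'; exact: (returnsD sX XM wX).
- exact: l0.
- by have := returns_period r Xp pn 1; rewrite mul1r.
- by have := returns_period r Xp pn (-1); rewrite mulN1r.
- by exfalso; apply: not_mixing; exact: (dense_returns_mixing sX r0 wX XM tX Xp n0 pn).
have [g gX gr] := transfer_function sX tX XM wX Xp n0 pn delta0 lattice.
exact: (positive_lattice_roof sX XM wX r0 delta0 gX gr).
Qed.
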